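(* Let $(\mathbb D,d)$ be a semimetric space and let $(\mathbb E,e)$ be a metric space. For integer $n\ge0$, let there be probability spaces $\Omega_n$, subsets $\mathbb D_n\subset\mathbb D$, maps $X_n:\Omega_n\to\mathbb D_n$ and maps $g_n:\mathbb D_n\to\mathbb E$. Assume the following two conditions: (1) For every $x_0\in\mathbb D_0$ and for every subsequence $(x_{n_k})_k$ with $x_{n_k}\in\mathbb D_{n_k}$ for all $k$ and such that $x_{n_k}\to x_0$ as $k\to\infty$, we have $g_{n_k}(x_{n_k})\to g_0(x_0)$. (2) The map $X_0$ is Borel measurable and $[X_n]\rightsquigarrow[X_0]$ in $([\mathbb D],d)$ as $n\to\infty$. If $g_0(X_0)$ is Borel measurable, then $g_n(X_n)\rightsquigarrow g_0(X_0)$ in $(\mathbb E,e)$. If $g_0(X_0)$ is not Borel measurable, there still exists a version $X_0'$ of $X_0$ such that $g_0(X_0')$ is Borel measurable, and thus $g_n(X_n)\rightsquigarrow g_0(X_0')$ in $(\mathbb E,e)$.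
   Context: A semimetric satisfies all axioms of a metric except that $d(x,y)=0$ need not imply $x=y$. For $x\in\mathbb D$, $[x]=\{y\in\mathbb D:d(x,y)=0\}$, and $[\mathbb D]=\{[x]:x\in\mathbb D\}$ is a metric space with $d([x],[y])=d(x,y)$; $[X]$ is the composition of $X$ with $x\mapsto[x]$. Borel $\sigma$-fields are generated by open sets. The maps $X_n$, $n\ge1$, and $g_n$ are arbitrary (no measurability or continuity assumed). In (1), $n_1<n_2<\cdots$ is a strictly increasing sequence of positive integers. A version of $X_0$ is a Borel measurable map $X_0'$ on $\Omega_0$ with values in $\mathbb D_0$ that is almost surely equal to $X_0$. Weak convergence is in the Hoffmann-Jørgensen sense: $Y_n\rightsquigarrow Y$ (with $Y$ Borel measurable) means $E^*[h(Y_n)]\to E[h(Y)]$ for every bounded continuous real function $h$, where $E^*$ is outer expectation. *)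

(* Defs.v *)
From HB Require Import structures.
From mathcomp Require Import all_boot all_order all_algebra.
From mathcomp Require Import generic_quotient.
From mathcomp Require Import all_classical all_reals all_analysis.
From mathcomp Require Import measurable_realfun.

Set Implicit Arguments.
Unset Strict Implicit.
Unset Printing Implicit Defensive.

Import Order.TTheory GRing.Theory Num.Theory.
Import numFieldNormedType.Exports.

Local Open Scope classical_set_scope.
Local Open Scope ring_scope.

(* [pseudoMetricType] only carries balls, and [metricType] separates points, so
   semimetric spaces get a structure of their own, in the style of
   [metricType]: the balls, hence the topology, are those of [sdist]. *)
HB.mixin Record PseudoMetric_isSemimetric (K : numDomainType) M
    & PseudoMetric K M := {
  sdist : M -> M -> K ;
  sdistxx : forall x, sdist x x = 0 ;
  sdist_sym : forall x y, sdist x y = sdist y x ;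
  sdist_triangle : forall y x z, sdist x z <= sdist x y + sdist y z ;
  ballEsdist : forall x r, ball x r = [set y | sdist x y < r]
}.

#[short(type="semimetricType")]
HB.structure Definition Semimetric (K : numDomainType) :=
  { M of PseudoMetric K M & PseudoMetric_isSemimetric K M }.

(* A semimetric in the usual sense, on a bare type, is enough. *)
HB.factory Record isSemimetric (K : numFieldType) (M : Type) & Choice M := {
  sdist : M -> M -> K ;
  sdistxx : forall x, sdist x x = 0 ;
  sdist_sym : forall x y, sdist x y = sdist y x ;
  sdist_triangle : forall y x z, sdist x z <= sdist x y + sdist y z
}.

HB.builders Context K M & isSemimetric K M.

Let ball (x : M) e : set M := [set y | sdist x y < e].

Let ent : set_system (M * M) := entourage_ ball.

Let nbhs (x : M) : set_system M := nbhs_ ent x.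

Let nbhsE : nbhs = nbhs_ ent. Proof. by []. Qed.

HB.instance Definition _ := hasNbhs.Build M nbhs.

Let ball_center x (e : K) : 0 < e -> ball x e x.
Proof. by move=> e0; rewrite /ball/= sdistxx. Qed.

Let ball_sym x y (e : K) : ball x e y -> ball y e x.
Proof. by rewrite /ball/= sdist_sym. Qed.

Let ball_triangle x y z e1 e2 : ball x e1 y -> ball y e2 z ->
  ball x (e1 + e2) z.
Proof.
by rewrite /ball/= => ? ?; rewrite (le_lt_trans (sdist_triangle y _ _))// ltrD.
Qed.

Let entourageE : ent = entourage_ ball. Proof. by []. Qed.

HB.instance Definition _ := @Nbhs_isPseudoMetric.Build K M
  ent nbhsE ball ball_center ball_sym ball_triangle entourageE.

Let ballEsdist x r : pseudometric_structure.ball x r = [set y | sdist x y < r].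
Proof. by []. Qed.

HB.instance Definition _ := PseudoMetric_isSemimetric.Build K M
  sdistxx sdist_sym sdist_triangle ballEsdist.

HB.end.

Section metric_quotient.
Local Open Scope quotient_scope.
Context {R : realType} (D : semimetricType R).

Lemma sdist_ge0 (x y : D) : 0 <= sdist x y.
Proof.
rewrite -(@pmulrn_lge0 _ _ 2)// -(sdistxx x).
by rewrite (le_trans (sdist_triangle y _ _))// sdist_sym -mulr2n.
Qed.

Definition sdist0 (x y : D) : bool := sdist x y == 0.

Let sdist0_refl : reflexive sdist0.
Proof. by move=> x; rewrite /sdist0 sdistxx. Qed.

Let sdist0_sym : symmetric sdist0.
Proof. by move=> x y; rewrite /sdist0 sdist_sym. Qed.

Let sdist0_trans : transitive sdist0.
Proof.
move=> y x z /eqP xy /eqP yz; rewrite /sdist0 eq_le sdist_ge0 andbT.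
by rewrite (le_trans (sdist_triangle y _ _))// xy yz addr0.
Qed.

Canonical sdist0_equiv := EquivRel sdist0 sdist0_refl sdist0_sym sdist0_trans.

Definition metric_quotient := {eq_quot sdist0}.

HB.instance Definition _ := Choice.on metric_quotient.

Definition class_of (x : D) : metric_quotient := \pi_({eq_quot sdist0}) x.

Lemma class_of_eq (x y : D) : class_of x = class_of y <-> sdist x y = 0.
Proof. by split=> [/eqmodP/eqP|xy]//; apply/eqmodP/eqP. Qed.

Definition qdist (a b : metric_quotient) : R :=
  sdist (repr (a : {eq_quot sdist0})) (repr (b : {eq_quot sdist0})).

(* [qdist] does not depend on the representatives. *)
Lemma qdistE (x y : D) : qdist (class_of x) (class_of y) = sdist x y.
Proof.
have rE z : sdist (repr (class_of z : {eq_quot sdist0})) z = 0.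
  by apply/class_of_eq; rewrite /class_of reprK.
rewrite /qdist; apply/eqP; rewrite eq_le; apply/andP; split.
  rewrite (le_trans (sdist_triangle x _ _))// rE add0r.
  by rewrite (le_trans (sdist_triangle y _ _))// (sdist_sym y) rE addr0.
rewrite (le_trans (sdist_triangle (repr (class_of x : {eq_quot sdist0})) _ _))//.
rewrite sdist_sym rE add0r.
rewrite (le_trans (sdist_triangle (repr (class_of y : {eq_quot sdist0})) _ _))//.
by rewrite rE addr0.
Qed.

Let qdistxx a : qdist a a = 0.
Proof. exact: sdistxx. Qed.

Let qdist_positivity a b : qdist a b = 0 -> a = b.
Proof.
rewrite -[a](@reprK _ {eq_quot sdist0}) -[b](@reprK _ {eq_quot sdist0}).
by rewrite qdistE => /class_of_eq.
Qed.

Let qdist_sym a b : qdist a b = qdist b a.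
Proof. exact: sdist_sym. Qed.

Let qdist_triangle b a c : qdist a c <= qdist a b + qdist b c.
Proof. exact: sdist_triangle. Qed.

HB.instance Definition _ := @isMetric.Build R metric_quotient qdist
  qdistxx qdist_positivity qdist_sym qdist_triangle.

End metric_quotient.

(* Stated directly because [g_sigma_algebraType] is a [measurableType] only over
   pointed types, which a subset of a space is not. *)
Definition borel_measurable {d} {Omega : measurableType d}
    {T : topologicalType} (Y : Omega -> T) : Prop :=
  forall B : set T, <<s @open T >> B -> measurable (Y @^-1` B).

(* The side condition on the positive and negative parts says that the
   expectation of U exists: the library's integral also has a (meaningless)
   value when both parts have an infinite integral. *)
Definition outer_expectation {d} {Omega : measurableType d} {R : realType}
    (P : probability Omega R) (Z : Omega -> \bar R) : \bar R :=
  ereal_inf [set (\int[P]_w U w)%E | U in [set U : Omega -> \bar R |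
    [/\ measurable_fun [set: Omega] U,
        (\int[P]_w (U^\+)%E w < +oo)%E \/ (\int[P]_w (U^\-)%E w < +oo)%E
      & forall w, (Z w <= U w)%E]]].

(* Weak convergence in the sense of Hoffmann-Jorgensen of arbitrary maps Y n to
   a Borel measurable map Y0, each map having its own probability space. *)
Definition weak_cvg {R : realType} {T : topologicalType}
    {disp : nat -> measure_display}
    {Omega : forall n, measurableType (disp n)}
    (P : forall n, probability (Omega n) R) (Y : forall n, Omega n -> T)
    {disp0 : measure_display} {Omega0 : measurableType disp0}
    (P0 : probability Omega0 R) (Y0 : Omega0 -> T) : Prop :=
  borel_measurable Y0 /\
  forall h : T -> R, continuous h -> (exists M, forall x, `|h x| <= M) ->
    outer_expectation (P n) (fun w => (h (Y n w))%:E) @[n --> \oo]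
      --> 'E_P0[h \o Y0]%E.

(* Main.v *)
(* For f_k = h \o g_k with h bounded and continuous, the sup-convolutions
   phi_m(a) = sup_{k > m, y in D_k} (f_k(y) - m d(a, y)) are bounded and
   m-Lipschitz, and dominate f_n(X_n) at X_n as soon as n > m.  Weak convergence
   of [X_n] therefore bounds limsup E* f_n(X_n) by E phi_m(X_0), and condition
   (1) says exactly that phi_m(x) eventually drops below h(g_0(x)) + eps for x
   in D_0; dominated convergence and the same argument for -h conclude, with no
   separability needed.  With f_k = 1, the same bound shows that X_0 almost
   surely lies in the set of limits of subsequences x_{n_k} in D_{n_k}; g_0 is
   continuous on that set, so X_0' only has to move X_0 into it. *)

Require Import Defs.
From HB Require Import structures.
From mathcomp Require Import all_boot all_order all_algebra.
From mathcomp Require Import all_classical all_reals all_analysis.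
From mathcomp Require Import measurable_realfun.
From mathcomp Require Import lra.

Import Order.TTheory GRing.Theory Num.Theory.
Import numFieldNormedType.Exports.

Local Open Scope classical_set_scope.
Local Open Scope ring_scope.

Set Implicit Arguments.
Unset Strict Implicit.
Unset Printing Implicit Defensive.

(** * Borel measurability of maps *)

Lemma measurable_comp_borel {d} {Omega : measurableType d} {R : realType}
    {T : topologicalType} (Y : Omega -> T) (h : T -> R) :
  borel_measurable Y -> continuous h -> measurable_fun [set: Omega] (h \o Y).
Proof.
move=> mY ch; apply: (measurability _ (RGenOInfty.measurableE R)) => //.
move=> _ [_ [x ->] <-]; rewrite setTI comp_preimage; apply: mY.
by apply: sub_sigma_algebra; apply: open_comp; [move=> ? _; exact: ch|].
Qed.

Lemma borel_measurable_comp {d} {Omega : measurableType d}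
    {T U : topologicalType} (Y : Omega -> T) (h : T -> U) :
  borel_measurable Y -> continuous h -> borel_measurable (h \o Y).
Proof.
move=> mY ch B; rewrite comp_preimage => sB.
suff : <<s @open T >> (h @^-1` B) by exact: mY.
apply: (sB [set B | <<s @open T >> (h @^-1` B)]); split; last first.
  move=> A oA; apply: sub_sigma_algebra.
  by apply: open_comp => // ? _; exact: ch.
split=> [|A sA|F sF] /=.
- exact: sigma_algebra0.
- by rewrite setTD preimage_setC -setTD; exact: sigma_algebraCD.
- by rewrite preimage_bigcup; exact: sigma_algebra_bigcup.
Qed.

Lemma borel_measurable_open {d} {Omega : measurableType d}
    {T : topologicalType} (Y : Omega -> T) :
  (forall A : set T, open A -> measurable (Y @^-1` A)) -> borel_measurable Y.
Proof.
move=> mY B sB; apply: (sB [set B | measurable (Y @^-1` B)]); split => //.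
split=> [|A sA|F sF] /=.
- by rewrite preimage_set0; exact: measurable0.
- by move: sA => /=; rewrite setTD preimage_setC => sA; exact: measurableC.
- by rewrite preimage_bigcup; exact: bigcupT_measurable.
Qed.

(** * Outer expectation *)

Section outer_expectation_theory.
Context {d} {Omega : measurableType d} {R : realType}.
Variable P : probability Omega R.
Implicit Types (U V : Omega -> \bar R) (W : Omega -> R).
Local Open Scope ereal_scope.

(** Integrability is not assumed: the integral is the difference of the integrals of the positive
    and negative parts, and each of these is monotone for nonnegative functions. *)
Lemma le_integral_measurable U V :
  measurable_fun [set: Omega] U -> measurable_fun [set: Omega] V ->
  (forall w, U w <= V w) -> \int[P]_w U w <= \int[P]_w V w.
Proof.
move=> mU mV UV; rewrite integralE [leRHS]integralE leeB//.
- apply: ge0_le_integral => //.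
  + exact: measurable_funepos.
  + exact: measurable_funepos.
  + by move=> x _; apply: (@funepos_le _ _ [set: Omega]); rewrite ?inE.
- apply: ge0_le_integral => //.
  + exact: measurable_funeneg.
  + exact: measurable_funeneg.
  + by move=> x _; apply: (@funeneg_le _ _ [set: Omega]); rewrite ?inE.
Qed.

Lemma integrable_bounded W (M : R) : measurable_fun [set: Omega] W ->
  (forall w, (`|W w| <= M)%R) -> P.-integrable [set: Omega] (EFin \o W).
Proof.
move=> mW WM; apply: measurable_bounded_integrable => //.
  by rewrite (le_lt_trans (probability_le1 P measurableT)) ?ltry.
exists M; split; first exact: num_real.
by move=> x Mx w _ /=; apply: (le_trans (WM w)); exact: ltW.
Qed.

Lemma le_outer_expectation (Z Z' : Omega -> \bar R) :
  (forall w, Z w <= Z' w) ->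
  outer_expectation P Z <= outer_expectation P Z'.
Proof.
move=> ZZ'; apply: ereal_inf_le_tmp => _ [U [mU eU Z'U]] <-.
by exists U => //; split => // w; apply: (le_trans (ZZ' w)).
Qed.

Lemma outer_expectation_ge_cst (r : R) (Z : Omega -> \bar R) :
  (forall w, r%:E <= Z w) -> r%:E <= outer_expectation P Z.
Proof.
move=> rZ; apply: le_ereal_inf_tmp => _ [U [mU eU ZU]] <-.
rewrite -[r%:E]mule1 -(probability_setT P) -integral_cst//.
by apply: le_integral_measurable => // w; apply: (le_trans (rZ w)).
Qed.

(** If [U] dominates [Z] and [V] dominates [- Z], then [- U <= V] pointwise, which can be
    integrated. This turns upper bounds for [- h] into lower bounds for [h]. *)
Lemma outer_expectation_ge_opp (Z : Omega -> \bar R) :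
  - outer_expectation P (fun w => - Z w) <= outer_expectation P Z.
Proof.
apply: le_ereal_inf_tmp => _ [U [mU eU ZU]] <-.
rewrite leeNl; apply: le_ereal_inf_tmp => _ [V [mV eV ZV]] <-.
rewrite -integralN.
  apply: le_integral_measurable => [|//|]; first exact: measurableT_comp.
  by move=> w; rewrite leeNl (le_trans _ (ZU w))// leeNl.
(* [integralN] has to exclude the form oo - oo; the condition that the expectation of [U] exists
   does so. *)
have U0 : 0 <= \int[P]_w U^\+ w by exact: integral_ge0.
have V0 : 0 <= \int[P]_w U^\- w by exact: integral_ge0.
by move: eU U0 V0; case: (\int[P]_w U^\+ w) => [r||];
  case: (\int[P]_w U^\- w) => [s||] //= [].
Qed.

End outer_expectation_theory.

(** * Lipschitz envelopes by sup-convolution *)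

Section sup_convolution.
Context {R : realType} {K : metricType R} {I : nat -> Type}.
Variables (c : forall k, I k -> K) (f : forall k, I k -> R) (M : R).
Hypothesis fM : forall k y, `|f (k := k) y| <= M.
Hypothesis M0 : 0 <= M.

(* The value [- M] keeps the supremum meaningful when no [I k] with [m < k] is
   inhabited. *)
Definition supconv_values (m : nat) (a : K) : set R :=
  [set - M] `|`
  [set r | exists k (y : I k), (m < k)%N /\ r = f y - m%:R * mdist a (c y)].

Definition supconv (m : nat) (a : K) : R := sup (supconv_values m a).

Let f_le k y : f (k := k) y <= M.
Proof. by have := fM y; rewrite ler_norml => /andP[]. Qed.

Let supconv_values_ub m a : ubound (supconv_values m a) M.
Proof.
move=> r [->|[k [y [_ ->]]]]; first by rewrite (le_trans _ M0)// oppr_le0.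
by rewrite (le_trans _ (f_le y))// gerBl mulr_ge0// mdist_ge0.
Qed.

Lemma le_supconv m a r : supconv_values m a r -> r <= supconv m a.
Proof. by apply: ub_le_sup; exists M; exact: supconv_values_ub. Qed.

Lemma supconv_le m a r : ubound (supconv_values m a) r -> supconv m a <= r.
Proof. by apply: ge_sup; exists (- M); left. Qed.

Lemma norm_supconv_le m a : `|supconv m a| <= M.
Proof.
rewrite ler_norml le_supconv; last by left.
exact: supconv_le.
Qed.

Lemma supconv_ge m k (y : I k) : (m < k)%N -> f y <= supconv m (c y).
Proof.
move=> mk; apply: le_supconv; right; exists k, y; split=> //.
by rewrite mdistxx mulr0 subr0.
Qed.

(** By the triangle inequality each penalty changes by at most [m%:R * mdist a b], whatever [f] and
    [c] are, and the default [- M] does not change. *)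
Lemma supconv_lipschitz m a b :
  supconv m a <= supconv m b + m%:R * mdist a b.
Proof.
have ab0 : 0 <= m%:R * mdist a b by rewrite mulr_ge0// mdist_ge0.
apply: supconv_le => r [->|[k [y [mk ->]]]].
  by rewrite (@le_trans _ _ (supconv m b))// ?lerDl//; apply: le_supconv; left.
rewrite -lerBlDr (@le_trans _ _ (f y - m%:R * mdist b (c y)))//; last first.
  by apply: le_supconv; right; exists k, y.
rewrite -addrA lerD2l -opprD lerN2 -mulrDr ler_wpM2l//.
by rewrite addrC (metric_sym a) metric_triangle.
Qed.

Lemma supconv_continuous m : continuous (supconv m).
Proof.
move=> a; apply/cvgrPdist_lt => e e0.
have d0 : 0 < e / m.+1%:R by rewrite divr_gt0.
apply/nbhs_ballP; exists (e / m.+1%:R) => // b.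
rewrite ballEmdist /= => ab; have : m%:R * mdist a b < e.
  rewrite (@le_lt_trans _ _ (m.+1%:R * mdist a b))//.
    by rewrite ler_wpM2r ?mdist_ge0// ler_nat.
  by rewrite mulrC -ltr_pdivlMr.
have := supconv_lipschitz m a b; have := supconv_lipschitz m b a.
by rewrite (metric_sym b) ltr_norml => ? ? ?; apply/andP; split; lra.
Qed.

(** Points within [m0.+1%:R^-1] of [a] contribute at most [r] by assumption. Farther ones pay at
    least [m / (m0 + 1)], which exceeds [2 * M] for large [m] and pushes them below [- M]. *)
Lemma supconv_le_near m0 a (r : R) : - M <= r ->
  (forall k (y : I k), (m0 < k)%N -> mdist a (c y) < m0.+1%:R^-1 -> f y <= r) ->
  \forall m \near \oo, supconv m a <= r.
Proof.
move=> Mr fr; set N := Num.bound (2 * M * m0.+1%:R).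
have NM : 2 * M * m0.+1%:R < N%:R.
  by apply: archi_boundP; rewrite !mulr_ge0.
exists (maxn m0 N) => // m /=; rewrite geq_max => /andP[m0m Nm].
apply: supconv_le => s [->//|[k [y [mk ->]]]].
have [ay|ay] := ltP (mdist a (c y)) m0.+1%:R^-1.
  rewrite (le_trans _ (fr _ _ (leq_ltn_trans m0m mk) ay))//.
  by rewrite gerBl mulr_ge0// mdist_ge0.
have : N%:R * m0.+1%:R^-1 <= m%:R * mdist a (c y).
  by rewrite ler_pM// ?ler_nat// invr_ge0.
have : 2 * M < N%:R * m0.+1%:R^-1 by rewrite ltr_pdivlMr.
move: (f_le y) Mr; move: (f y) (N%:R / _) (m%:R * _) => u v t.
by move=> ? ? ? ?; lra.
Qed.

End sup_convolution.

(** * Asymptotic upper bound for outer expectations *)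

Lemma cvge_near_le {R : realType} (u : nat -> \bar R) (l e : R) :
  u n @[n --> \oo] --> l%:E -> 0 < e ->
  \forall n \near \oo, (u n <= (l + e)%:E)%E.
Proof.
move=> /fine_cvgP[ufin ul] e0; near=> n.
have un : u n \is a fin_num by near: n.
rewrite -(fineK un) lee_fin ltW//; near: n.
by apply: (cvgr_lt l) => //; rewrite ltrDl.
Unshelve. all: by end_near. Qed.

Lemma near_cvge {R : realType} (u : nat -> \bar R) (l : R) :
  (forall e, 0 < e -> \forall n \near \oo, (u n <= (l + e)%:E)%E) ->
  (forall e, 0 < e -> \forall n \near \oo, ((l - e)%:E <= u n)%E) ->
  u n @[n --> \oo] --> l%:E.
Proof.
move=> ule uge; apply/fine_cvgP; split.
  near=> n; rewrite fin_numE -ltNye -ltey.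
  apply/andP; split.
    rewrite (@lt_le_trans _ _ (l - 1)%:E)// ?ltNyr//; near: n; exact: uge.
  rewrite (@le_lt_trans _ _ (l + 1)%:E)// ?ltry//; near: n; exact: ule.
apply/cvgrPdist_le => e e0; near=> n.
have : (u n <= (l + e)%:E)%E by near: n; exact: ule.
have : ((l - e)%:E <= u n)%E by near: n; exact: uge.
rewrite /=; case: (u n) => [r||] //=; rewrite !lee_fin => ? ?.
by rewrite ler_norml; apply/andP; split; lra.
Unshelve. all: by end_near. Qed.

(** An index [m] is fixed first, so that the envelope at [Y0] has expectation at most that of [W]
    plus [e / 2]; weak convergence is then applied to this single continuous function. *)
Lemma limsup_outer_expectation {R : realType} {K : metricType R}
    {disp : nat -> measure_display}
    {Omega : forall n, measurableType (disp n)}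
    (P : forall n, probability (Omega n) R)
    {disp0 : measure_display} {Omega0 : measurableType disp0}
    (P0 : probability Omega0 R) {I : nat -> Type}
    (c : forall k, I k -> K) (f : forall k, I k -> R) (M : R)
    (X : forall n, Omega n -> I n) (Y0 : Omega0 -> K) (W : Omega0 -> R) :
  0 <= M -> (forall k y, `|f k y| <= M) ->
  weak_cvg P (fun n w => c n (X n w)) P0 Y0 ->
  measurable_fun [set: Omega0] W -> (forall w, `|W w| <= M) ->
  (forall w e, 0 < e ->
    \forall m \near \oo, supconv c f M m (Y0 w) <= W w + e) ->
  forall e, 0 < e -> \forall n \near \oo,
    (outer_expectation (P n) (fun w => (f n (X n w))%:E)
       <= 'E_P0[W] + e%:E)%E.
Proof.
move=> M0 fM [mY0 cY] mW WM YW e e0.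
pose phi m := supconv c f M m.
have phiM m a : `|phi m a| <= M by exact: norm_supconv_le.
have cphi m : continuous (phi m) by exact: supconv_continuous.
(* The envelopes are only bounded above by [W] in the limit; their maximum with [W] converges
   pointwise to [W], so dominated convergence applies. *)
pose F m := (phi m \o Y0) \max W.
have mphi m : measurable_fun [set: Omega0] (phi m \o Y0).
  exact: measurable_comp_borel.
have mF m : measurable_fun [set: Omega0] (F m).
  exact: (measurable_maxr (mphi m) mW).
have FM m w : `|F m w| <= M.
  rewrite /F /=.
  by case: (leP (phi m (Y0 w)) (W w)) => _; [exact: WM|exact: phiM].
have FW w : (F m w)%:E @[m --> \oo] --> (W w)%:E.
  apply: near_cvge => r r0; last first.
    by apply: nearW => m; rewrite lee_fin /F /= le_max gerBl (ltW r0) orbT.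
  have := YW w r r0; apply: filterS => m Ym.
  by rewrite lee_fin /F /= ge_max Ym lerDl ltW.
have iW := integrable_bounded P0 mW WM.
have EW : ('E_P0[W] = (fine 'E_P0[W])%:E)%E.
  by rewrite fineK// unlock; exact: integrable_fin_num.
have e20 : 0 < e / 2 by rewrite divr_gt0.
have cF : (\int[P0]_w (F m w)%:E)%E @[m --> \oo] --> (fine 'E_P0[W])%:E.
  rewrite -EW unlock.
  apply: (@dominated_cvg _ _ _ P0 _ measurableT (fun m => EFin \o F m) _
    (cst M%:E)) => //.
  - by move=> m; exact/measurable_EFinP.
  - by move=> w _; exact: FW.
  - apply: (@integrable_bounded _ _ _ P0 (cst M) M) => // w.
    by rewrite /= ger0_norm.
  - by move=> m w _; rewrite /= lee_fin.
have [m _ /(_ _ (leqnn m)) Fm] := cvge_near_le cF e20.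
have iphi := integrable_bounded P0 (mphi m) (fun w => phiM m (Y0 w)).
have Ephi : ('E_P0[phi m \o Y0] = (fine 'E_P0[phi m \o Y0])%:E)%E.
  by rewrite fineK// unlock; exact: integrable_fin_num.
have phiF : (fine 'E_P0[phi m \o Y0] <= fine 'E_P0[W] + e / 2).
  rewrite -lee_fin -Ephi (le_trans _ Fm)// unlock.
  apply: le_integral_measurable.
  - exact/measurable_EFinP.
  - exact/measurable_EFinP.
  - by move=> w; rewrite lee_fin /F /= le_max lexx.
have := cY _ (cphi m) (ex_intro _ M (phiM m)).
rewrite Ephi => /cvge_near_le/(_ e20) => cphiY; near=> n.
have /le_trans : (outer_expectation (P n) (fun w => (f n (X n w))%:E) <=
    outer_expectation (P n) (fun w => (phi m (c n (X n w)))%:E))%E.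
  apply: le_outer_expectation => w; rewrite lee_fin.
  by apply: supconv_ge => //; near: n; exact: nbhs_infty_gt.
apply; apply: (@le_trans _ _ (fine 'E_P0[phi m \o Y0] + e / 2)%:E).
  by near: n.
by rewrite EW -EFinD lee_fin; lra.
Unshelve. all: by end_near. Qed.

Lemma class_of_continuous {R : realType} (D : semimetricType R) :
  continuous (@class_of R D).
Proof.
move=> x A /nbhs_ballP[e e0 eA]; apply/nbhs_ballP; exists e => // y.
rewrite ballEsdist /= => xy; apply: eA.
by rewrite ballEmdist /= [mdist _ _]qdistE.
Qed.

Unset Implicit Arguments.

(** * The mapping theorem when the image of the limit is Borel *)

Section extended_mapping.
Context {R : realType} {D : semimetricType R} {E : metricType R}.
Context {disp : nat -> measure_display}.
Context {Omega : forall n, measurableType (disp n)}.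
Variables (P : forall n, probability (Omega n) R) (Dn : nat -> set D).
Variables (X : forall n, Omega n -> set_type (Dn n)).
Variable g : forall n, set_type (Dn n) -> E.
Hypothesis g_cvg : forall (x0 : set_type (Dn 0%N)) (nk : nat -> nat)
    (x : forall k, set_type (Dn (nk k))),
  (forall k, (0 < nk k)%N) -> (forall k, (nk k < nk k.+1)%N) ->
  set_val (x k) @[k --> \oo] --> (set_val x0 : D) ->
  g (nk k) (x k) @[k --> \oo] --> g 0%N x0.

Let cls {k} (y : set_type (Dn k)) : metric_quotient D := class_of (set_val y).

Let mdist_cls {k l} (y : set_type (Dn k)) (z : set_type (Dn l)) :
  mdist (cls y) (cls z) = sdist (set_val y) (set_val z).
Proof. by rewrite [mdist _ _]qdistE. Qed.

(** Uniform form of the sequential hypothesis [g_cvg]. Otherwise every [m] has a bad point of index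
    above [m] within [m.+1%:R^-1] of [x0], and iterating the choice gives a subsequence that
    converges to [x0] while its images avoid [V]. *)
Lemma extended_cvg_near (x0 : set_type (Dn 0%N)) (V : set E) :
  nbhs (g 0%N x0) V -> exists m, forall k (y : set_type (Dn k)), (m < k)%N ->
    sdist (set_val x0) (set_val y) < m.+1%:R^-1 -> V (g k y).
Proof.
move=> x0V; apply: contrapT => /forallNP noV.
have {noV}/choice[F FP] m : exists q : {k & set_type (Dn k)},
    [/\ (m < tag q)%N,
        sdist (set_val x0) (set_val (tagged q)) < m.+1%:R^-1
      & ~ V (g (tag q) (tagged q))].
  apply: contrapT => noq; apply: (noV m) => k y mk ky.
  apply: contrapT => nV; apply: noq.
  by exists (Tagged (fun k => set_type (Dn k)) y).
(* The indices [tag (F (u k))], that is [u k.+1], are positive and strictly increasing, and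
   [k <= u k] makes the distances to [x0] tend to 0. *)
pose u := fix u j := if j is i.+1 then tag (F (u i)) else 0%N.
have uS j : (u j < u j.+1)%N by have [] := FP (u j).
have ju j : (j <= u j)%N by elim: j => // j IH; exact: leq_ltn_trans (uS j).
have cx : set_val (tagged (F (u k))) @[k --> \oo] --> (set_val x0 : D).
  apply/cvg_ballP => e e0; near=> n.
  rewrite ballEsdist /=; have [_ /lt_le_trans + _] := FP (u n); apply.
  rewrite (@le_trans _ _ n.+1%:R^-1)//.
    by rewrite lef_pV2 ?posrE// ler_nat ltnS.
  by rewrite ltW//; near: n; exact: (near_infty_natSinv_lt (PosNum e0)).
have := g_cvg _ (fun k => tag (F (u k))) _ (fun k => leq_ltn_trans
  (leq0n _) (uS k)) (fun k => uS k.+1) cx.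
move=> /(_ _ x0V)[N _ /(_ N (leqnn N))].
by have [_ _] := FP (u N).
Unshelve. all: by end_near. Qed.

(** [X0] and its space are not tied to [X 0], so the lemma also serves a modified limit. The upper
    bound is applied to both [h] and [- h]. *)
Lemma extended_mapping {disp0 : measure_display}
    {Omega0 : measurableType disp0} (P0 : probability Omega0 R)
    (X0 : Omega0 -> set_type (Dn 0%N)) :
  weak_cvg P (fun n w => cls (X n w)) P0 (fun w => cls (X0 w)) ->
  borel_measurable (fun w => g 0%N (X0 w)) ->
  weak_cvg P (fun n w => g n (X n w)) P0 (fun w => g 0%N (X0 w)).
Proof.
move=> X_cvg mgX0; split=> // h ch [M' hM'].
have [M M0 hM] : exists2 M : R, 0 <= M & forall x, `|h x| <= M.
  by exists `|M'| => // x; rewrite (le_trans (hM' x))// ler_norm.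
have mh (k : E -> R) : continuous k ->
    measurable_fun [set: Omega0] (k \o (g 0 \o X0)).
  by move=> ck; exact: measurable_comp_borel.
have limsup (k : E -> R) : continuous k -> (forall x, `|k x| <= M) ->
    forall e : R, 0 < e -> \forall n \near \oo,
    (outer_expectation (P n) (fun w => (k (g n (X n w)))%:E)
      <= 'E_P0[k \o (g 0 \o X0)] + e%:E)%E.
  move=> ck kM; apply: (limsup_outer_expectation (c := @cls)
    (f := fun n y => k (g n y)) M0 (fun n y => kM (g n y)) X_cvg (mh k ck)).
    by move=> w; exact: kM.
  move=> w e e0.
  (* This neighbourhood of [g 0 (X0 w)] yields the local bound on [k (g n y)] that [supconv_le_near]
     asks for. *)
  have [|m gm] := @extended_cvg_near (X0 w)
      [set z | k z < k (g 0 (X0 w)) + e].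
    by apply: (cvgr_lt (k (g 0 (X0 w))) (ck _)); rewrite ltrDl.
  apply: (supconv_le_near (fun n y => kM (g n y)) M0 (m0 := m)).
    have := kM (g 0 (X0 w)); rewrite ler_norml => /andP[Mk _].
    by rewrite (le_trans Mk)// lerDl ltW.
  by move=> n y mn; rewrite mdist_cls => ?; exact/ltW/gm.
have ih := integrable_bounded P0 (mh h ch) (fun w => hM _).
have Eh : ('E_P0[h \o (g 0 \o X0)] = (fine 'E_P0[h \o (g 0 \o X0)])%:E)%E.
  by rewrite fineK// unlock; exact: integrable_fin_num.
pose h' x : R := - h x.
have EN : ('E_P0[h' \o (g 0 \o X0)] = - 'E_P0[h \o (g 0 \o X0)])%E.
  rewrite unlock -integralN//.
  by rewrite fin_num_adde_defl// fin_numN integrable_neg_fin_num.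
rewrite [X in _ --> X]Eh; apply: near_cvge => e e0.
  by have := limsup h ch hM e e0; apply: filterS => n; rewrite Eh -EFinD.
have cNh : continuous h' by move=> x; apply: cvgN; exact: ch.
have Nh x : `|h' x| <= M by rewrite normrN.
have := limsup _ cNh Nh e e0; apply: filterS => n.
rewrite EN Eh -EFinN -EFinD => le_e.
rewrite (le_trans _ (outer_expectation_ge_opp _ _))//.
by rewrite leeNr -EFinN opprB addrC.
Qed.

(** * Almost sure reachability of the limit *)

Let one k (_ : set_type (Dn k)) : R := 1.

(** This is the larger of [-1] and [1 - m * delta], where [delta] is the distance from the argument
    to the classes of points of the [Dn k] with [k > m]; it is [-1] if there are no such points. *)
Let reach m := supconv (@cls) one 1 m.

Let norm1 k (y : set_type (Dn k)) : `|one k y| <= 1.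
Proof. by rewrite normr1. Qed.

Let continuous_reach m : continuous (reach m).
Proof. exact: supconv_continuous norm1 ler01 m. Qed.

(* [reachable (cls x)] means that x is the limit of some subsequence of points
   of the Dn k. *)
Let reachable (a : metric_quotient D) := forall m, 1 <= reach m a.

(** For [n > m] the point [X n w] itself shows that [reach m] is at least 1 at its class. In the
    limit [reach m (Y0 w)] has expectation at least 1 without ever exceeding 1, hence equals 1
    almost surely, for all of the countably many [m] at once. *)
Lemma ae_reachable {disp0 : measure_display}
    {Omega0 : measurableType disp0} (P0 : probability Omega0 R)
    (Y0 : Omega0 -> metric_quotient D) :
  weak_cvg P (fun n w => cls (X n w)) P0 Y0 ->
  \forall w \ae P0, reachable (Y0 w).
Proof.
move=> [mY0 cY]; apply: ae_foralln => m.
have reach1 a : `|reach m a| <= 1 by exact: norm_supconv_le norm1 ler01 m a.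
have mr : measurable_fun [set: Omega0] (reach m \o Y0).
  exact: measurable_comp_borel.
have ir := integrable_bounded P0 mr (fun w => reach1 _).
have Er : ('E_P0[reach m \o Y0] = (fine 'E_P0[reach m \o Y0])%:E)%E.
  by rewrite fineK// unlock; exact: integrable_fin_num.
have Er1 : (1 <= 'E_P0[reach m \o Y0])%E.
  rewrite Er lee_fin; apply/ler_addgt0Pr => e e0.
  have := cY _ (continuous_reach m) (ex_intro _ 1 reach1).
  rewrite Er => /cvge_near_le/(_ e0) cr.
  near \oo => n; rewrite -lee_fin.
  rewrite (@le_trans _ _ (outer_expectation (P n)
    (fun w => (reach m (cls (X n w)))%:E)))//; last by near: n.
  apply: outer_expectation_ge_cst => w; rewrite lee_fin.
  apply: (@supconv_ge _ _ _ (@cls) _ _ norm1 ler01 m n (X n w)).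
  near: n; exact: nbhs_infty_gt.
have i1 : P0.-integrable [set: Omega0] (EFin \o cst 1).
  by apply: (@integrable_bounded _ _ _ P0 _ 1) => // w; rewrite /= normr1.
have m1r : measurable_fun [set: Omega0]
    (fun w => (1%:E - (reach m (Y0 w))%:E)%E).
  by apply: emeasurable_funB => //; exact/measurable_EFinP.
have /(ae_eq_integral_abs P0 measurableT m1r) :
    (\int[P0]_w `|1%:E - (reach m (Y0 w))%:E| = 0)%E.
  apply/eqP; rewrite eq_le integral_ge0// andbT.
  under eq_integral => w _.
    rewrite gee0_abs; last first.
      rewrite -EFinB lee_fin subr_ge0.
      by have := reach1 (Y0 w); rewrite ler_norml => /andP[].
    over.
  rewrite [leLHS](integralB measurableT i1 ir)//.
  rewrite (integral_cst P0 measurableT 1%:E) mul1e.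
  rewrite sube_le0 (le_trans (probability_le1 P0 measurableT))//.
  by move: Er1; rewrite unlock.
apply: filterS => w /(_ I)/= /eqP; rewrite -EFinB eqe subr_eq0.
by move=> /eqP <-.
Unshelve. all: by end_near. Qed.

(** * Continuity of [g 0] on reachable points, and the version of the limit *)

Let continuous_val : continuous (set_val : set_type (Dn 0%N) -> D).
Proof. exact: initial_continuous. Qed.

Lemma reachable_near (x : set_type (Dn 0%N)) m (e : R) :
  reachable (cls x) -> 0 < e ->
  exists k (y : set_type (Dn k)),
    (m < k)%N /\ sdist (set_val x) (set_val y) < e.
Proof.
(* Level [m.+1] keeps the penalty factor at least 1 even for [m = 0]; with no point within [e], the
   supremum would then stay strictly below 1. *)
move=> /(_ m.+1) rx e0; apply: contrapT => nky.
have : reach m.+1 (cls x) <= Num.max (-1) (1 - e).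
  apply: supconv_le => r [->|[k [y [mk ->]]]]; first by rewrite le_max lexx.
  rewrite le_max; apply/orP; right; rewrite lerD2l lerN2 mdist_cls.
  have ey : e <= sdist (set_val x) (set_val y).
    rewrite leNgt; apply/negP => ye; apply: nky; exists k, y; split=> //.
    exact: ltnW.
  by rewrite (le_trans ey)// ler_peMl ?(le_trans (ltW e0) ey)// ler1n.
by move=> /(le_trans rx); rewrite le_max => /orP[]; lra.
Qed.

(** A reachable [z] near [x] is approximated by some [y] in [Dn k] with [k] large; this [y] is close
    to [x] as well, so [g k y] is within [e / 2] of both [g 0 x] and [g 0 z]. *)
Lemma nbhs_reachable (x : set_type (Dn 0%N)) (V : set E) :
  reachable (cls x) -> nbhs (g 0%N x) V ->
  \forall z \near x, reachable (cls z) -> V (g 0%N z).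
Proof.
move=> rx /nbhs_ballP[e /= e0 eV]; have e20 : 0 < e / 2 by rewrite divr_gt0.
have [m1 gm1] := extended_cvg_near _ _ (nbhsx_ballx (g 0%N x) _ e20).
have d0 : 0 < m1.+1%:R^-1 / 2 :> R by rewrite divr_gt0.
have : \forall z \near x,
    sdist (set_val x : D) (set_val z) < m1.+1%:R^-1 / 2.
  have := nbhsx_ballx (set_val x : D) _ d0; rewrite ballEsdist.
  by move=> /(continuous_val x).
apply: filterS => z xz rz; apply: eV.
have [m2 gm2] := extended_cvg_near _ _ (nbhsx_ballx (g 0%N z) _ e20).
(* The first bound, added to the distance from [x] to [z], puts [y] within [m1.+1%:R^-1] of [x]; the
   second serves [gm2] at [z]. *)
have d'0 : 0 < Num.min (m1.+1%:R^-1 / 2) m2.+1%:R^-1 :> R.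
  by rewrite lt_min d0 invr_gt0 ltr0n.
have [k [y [mk]]] := reachable_near _ (maxn m1 m2) _ rz d'0.
rewrite lt_min => /andP[zy1 zy2]; move: mk; rewrite gtn_max => /andP[m1k m2k].
have zy := gm2 _ _ m2k zy2.
apply: (@ball_splitl _ _ (g k y)) zy; apply: gm1 => //.
rewrite (le_lt_trans (sdist_triangle (set_val z) _ _))//.
by rewrite [ltRHS]splitr ltrD.
Qed.

Let measurable_reachable {disp0 : measure_display}
    {Omega0 : measurableType disp0} (Y0 : Omega0 -> metric_quotient D) :
  borel_measurable Y0 -> measurable [set w | reachable (Y0 w)].
Proof.
move=> mY0.
have -> : [set w | reachable (Y0 w)] =
    \bigcap_m ((reach m \o Y0) @^-1` `[1, +oo[).
  apply/seteqP; split=> w /= rw.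
    by move=> m _ /=; rewrite in_itv /= andbT; exact: rw.
  by move=> m; have := rw m I; rewrite /= in_itv /= andbT.
apply: bigcapT_measurable => m; rewrite -[X in measurable X]setTI.
exact: measurable_comp_borel.
Qed.

(** [X0'] replaces the unreachable values of [X0] by one fixed reachable value. This happens with
    probability zero, so expectations in the weak limit of the classes are unchanged. *)
Lemma extended_mapping_version {disp0 : measure_display}
    {Omega0 : measurableType disp0} (P0 : probability Omega0 R)
    (X0 : Omega0 -> set_type (Dn 0%N)) :
  borel_measurable X0 ->
  weak_cvg P (fun n w => cls (X n w)) P0 (fun w => cls (X0 w)) ->
  exists X0' : Omega0 -> set_type (Dn 0%N),
    [/\ borel_measurable X0', \forall w \ae P0, X0' w = X0 w,
        borel_measurable (fun w => g 0%N (X0' w))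
      & weak_cvg P (fun n w => g n (X n w)) P0 (fun w => g 0%N (X0' w))].
Proof.
move=> mX0 X_cvg; have aer := ae_reachable P0 _ X_cvg.
have [w0 rw0] : exists w, reachable (cls (X0 w)).
  apply: contrapT => /forallNP nr.
  have [N [_ N0 sN]] := aer; have NT : N = [set: Omega0].
    by apply/seteqP; split=> // w _; apply: sN; exact: nr.
  have := probability_setT P0; rewrite -NT N0 => /eqP.
  by rewrite eqe eq_sym oner_eq0.
pose X0' w := if `[< reachable (cls (X0 w)) >] then X0 w else X0 w0.
have rX0' w : reachable (cls (X0' w)).
  by rewrite /X0'; case: ifPn => [/asboolP|].
have X0'E : \forall w \ae P0, X0' w = X0 w.
  by apply: filterS aer => w rw; rewrite /X0' asboolT.
have mr : measurable [set w | reachable (cls (X0 w))].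
  by apply: measurable_reachable; case: X_cvg.
have mX0' : borel_measurable X0'.
  apply: borel_measurable_open => A oA.
  have mA : measurable (X0 @^-1` A).
    by apply: mX0; exact: sub_sigma_algebra.
  have [Aw0|Aw0] := pselect (A (X0 w0)).
    have -> : X0' @^-1` A =
        X0 @^-1` A `|` ~` [set w | reachable (cls (X0 w))].
      apply/seteqP; split=> w /=; rewrite /X0'.
        by case: ifPn => [_|/asboolPn]; [left|right].
      by case: ifPn => [/asboolP rw []|].
    by apply: measurableU => //; exact: measurableC.
  have -> : X0' @^-1` A = X0 @^-1` A `&` [set w | reachable (cls (X0 w))].
    apply/seteqP; split=> w /=; rewrite /X0'.
      by case: ifPn => [/asboolP|].
    by move=> [Aw rw]; rewrite asboolT.
  exact: measurableI.
have mg : borel_measurable (fun w => g 0%N (X0' w)).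
  apply: borel_measurable_open => V oV.
  (* The preimage of [V] under [g 0] need not be Borel, but it agrees with the open set [O] on
     reachable points, and [X0'] takes only such values. *)
  pose O : set (set_type (Dn 0%N)) :=
    interior [set z | reachable (cls z) -> V (g 0%N z)].
  have -> : (fun w => g 0%N (X0' w)) @^-1` V = X0' @^-1` O.
    apply/seteqP; split=> w /=.
      by move=> Vw; apply: nbhs_reachable => //; exact: open_nbhs_nbhs.
    by move=> /interior_subset; apply.
  by apply: mX0'; apply: sub_sigma_algebra; exact: open_interior.
exists X0'; split=> //; apply: extended_mapping => //.
have mcls : borel_measurable (fun w => cls (X0' w)).
  apply: borel_measurable_comp mX0' _ => x.
  by apply: continuous_comp; [exact: continuous_val|exact: class_of_continuous].
split=> // h ch hM.
rewrite [X in _ --> X](_ : _ = 'E_P0[h \o (fun w => cls (X0 w))])%E.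
  by case: X_cvg => _; apply.
rewrite unlock; apply: ae_eq_integral => //.
- by apply/measurable_EFinP; exact: measurable_comp_borel mcls ch.
- by apply/measurable_EFinP; apply: measurable_comp_borel ch; case: X_cvg.
- by apply: filterS X0'E => w /= ->.
Qed.

End extended_mapping.

Theorem theorem8p3 (R : realType) (D : semimetricType R) (E : metricType R)
    (disp : nat -> measure_display)
    (Omega : forall n, measurableType (disp n))
    (P : forall n, probability (Omega n) R)
    (Dn : nat -> set D)
    (X : forall n, Omega n -> set_type (Dn n))
    (g : forall n, set_type (Dn n) -> E)
    (g_cvg : forall (x0 : set_type (Dn 0%N)) (nk : nat -> nat)
        (x : forall k, set_type (Dn (nk k))),
      (forall k, (0 < nk k)%N) -> (forall k, (nk k < nk k.+1)%N) ->
      set_val (x k) @[k --> \oo] --> (set_val x0 : D) ->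
      g (nk k) (x k) @[k --> \oo] --> g 0%N x0)
    (X0_measurable : borel_measurable (X 0%N))
    (X_cvg : weak_cvg P (fun n w => class_of (set_val (X n w)))
                      (P 0%N) (fun w => class_of (set_val (X 0%N w)))) :
  (borel_measurable (fun w => g 0%N (X 0%N w)) ->
     weak_cvg P (fun n w => g n (X n w)) (P 0%N) (fun w => g 0%N (X 0%N w)))
  /\
  (~ borel_measurable (fun w => g 0%N (X 0%N w)) ->
     exists X0' : Omega 0%N -> set_type (Dn 0%N),
       [/\ borel_measurable X0',
           \forall w \ae P 0%N, X0' w = X 0%N w,
           borel_measurable (fun w => g 0%N (X0' w))
         & weak_cvg P (fun n w => g n (X n w)) (P 0%N)
                      (fun w => g 0%N (X0' w))]).
Proof.
split=> [mgX0|_]; first exact: extended_mapping.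
exact: extended_mapping_version.
Qed.
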